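(* For $i\in\{1,2,3\}$ let $N_i$ be the simply connected Lie group with Lie algebra $\mathfrak n_i$, endowed with the left-invariant HKT structure described in the context, and let $\nabla$ be its Bismut connection and $c$ its torsion 3-form. Then $c$ is parallel, $\nabla c=0$, on $N_1$, while $\nabla c\neq0$ on $N_2$ and on $N_3$.
   Context: The Lie algebras $\mathfrak n_1,\mathfrak n_2,\mathfrak n_3$ are 8-dimensional with basis $e_1,\dots,e_8$ and the following non-zero brackets (up to skew-symmetry): $\mathfrak n_1$: $[e_1,e_2]=-[e_3,e_4]=e_5$; $\mathfrak n_2$: $[e_1,e_3]=[e_2,e_4]=e_6$, $[e_1,e_4]=-[e_2,e_3]=e_7$; $\mathfrak n_3$: $[e_1,e_2]=-[e_3,e_4]=e_5$, $[e_1,e_3]=[e_2,e_4]=e_6$, $[e_1,e_4]=-[e_2,e_3]=e_7$. On each of them the hypercomplex structure is determined by $J_ie_1=e_{i+1}$, $J_ie_5=e_{5+i}$ ($i=1,2,3$), $J_i^2=-I$, $J_1J_2=-J_2J_1=J_3$; it satisfies $[J_iX,J_iY]=[X,Y]$. The inner product $g$ is the one for which $e_1,\dots,e_8$ is orthonormal. Left translation gives an invariant HKT structure on the simply connected group $N_i$: there is a unique connection $\nabla$ (the Bismut connection) with $\nabla g=0$, $\nabla J_i=0$ ($i=1,2,3$) and with $c(X,Y,Z)=g(X,T(Y,Z))$ a 3-form, where $T$ is the torsion of $\nabla$; $c$ is called the torsion 3-form. *)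

(* Defs.v *)
From HB Require Import structures.
From mathcomp Require Import all_boot all_order all_algebra.
From mathcomp Require Import all_classical all_reals all_analysis.
From mathcomp Require Import ring.

Set Implicit Arguments.
Unset Strict Implicit.
Unset Printing Implicit Defensive.

Import Order.TTheory GRing.Theory Num.Theory.
Import numFieldNormedType.Exports.
Local Open Scope ring_scope.

(* The simply connected nilpotent groups N_1, N_2, N_3 are 2-step, so in
   exponential coordinates each of them is the manifold R^8 with the
   Baker-Campbell-Hausdorff product x + y + [x, y] / 2.  Vector fields, metric,
   complex structures and connections live on that manifold; its tangent spaces
   are identified with R^8.  [gmulA], [gmul0], [gmulV] give the group laws and
   [lie_bracket_from_unit] identifies the Lie algebra of the group. *)

Section Coordinates.
Variable R : realType.

(* Indices are 1-based: e 1, ..., e 8 is the basis, co 1, ..., co 8 the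
   coordinates; other indices are junk values. *)
Definition e (k : nat) : 'rV[R]_8 := delta_mx ord0 (inord k.-1).
Definition co (k : nat) (x : 'rV[R]_8) : R := x ord0 (inord k.-1).

End Coordinates.

(* The entry [br i j k s] stands for [e_i, e_j] = s e_k; brackets of basis
   vectors that are not listed, up to skew-symmetry, vanish. *)
Definition brackets := seq (nat * nat * nat * int).
Definition br (i j k : nat) (s : int) : nat * nat * nat * int := (i, j, k, s).

Definition n1 : brackets := [:: br 1 2 5 1; br 3 4 5 (-1)].
Definition n2 : brackets :=
  [:: br 1 3 6 1; br 2 4 6 1; br 1 4 7 1; br 2 3 7 (-1)].
Definition n3 : brackets := n1 ++ n2.

Section Group.
Variables (R : realType) (n : brackets).
Local Notation V := 'rV[R]_8.

Definition lie (x y : V) : V :=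
  \sum_(t <- n) let: (i, j, k, s) := t in
    (s%:~R * (co i x * co j y - co j x * co i y)) *: e R k.

Definition gmul (x y : V) : V := x + y + 2^-1 *: lie x y.

(* The unit of the group is 0 and the inverse of x is - x. *)
Definition ginv (x : V) : V := - x.

(* The differential at q of the left translation by p, T_q N -> T_(pq) N. *)
Definition dleft (p q : V) (v : V) : V := 'D_v (gmul p) q.

(* T_0 N -> T_p N and its inverse T_p N -> T_0 N (the Maurer-Cartan form). *)
Definition from_unit (p : V) (v : V) : V := dleft p 0 v.
Definition to_unit (p : V) (v : V) : V := dleft (ginv p) p v.

End Group.

Section Fields.
Variable R : realType.
Local Notation V := 'rV[R]_8.

(* All iterated directional derivatives exist and are differentiable. *)
Definition smooth (W : normedModType R) (f : V -> W) : Prop :=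
  forall (vs : seq V) (p : V),
    differentiable (foldl (fun (h : V -> W) v => fun q => 'D_v h q) f vs) p.

Definition lie_bracket (X Y : V -> V) : V -> V :=
  fun p => 'D_(X p) Y p - 'D_(Y p) X p.

Definition connection := (V -> V) -> (V -> V) -> (V -> V).

(* Operators on vector fields are total functions on V -> V; only their values
   on smooth fields are constrained or used. *)
Definition is_connection (D : connection) : Prop :=
  [/\ forall X Y, smooth X -> smooth Y -> smooth (D X Y),
      forall X X' Y, smooth X -> smooth X' -> smooth Y ->
        forall p, D (fun q => X q + X' q) Y p = D X Y p + D X' Y p,
      forall (f : V -> R) X Y, smooth f -> smooth X -> smooth Y ->
        forall p, D (fun q => f q *: X q) Y p = f p *: D X Y p,
      forall X Y Y', smooth X -> smooth Y -> smooth Y' ->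
        forall p, D X (fun q => Y q + Y' q) p = D X Y p + D X Y' p
    & forall (f : V -> R) X Y, smooth f -> smooth X -> smooth Y ->
        forall p, D X (fun q => f q *: Y q) p =
                  'D_(X p) f p *: Y p + f p *: D X Y p].

Definition torsion (D : connection) (X Y : V -> V) : V -> V :=
  fun p => D X Y p - D Y X p - lie_bracket X Y p.

(* Covariant tensors, as functions of vector fields. *)
Definition tensor2 := (V -> V) -> (V -> V) -> V -> R.
Definition tensor3 := (V -> V) -> (V -> V) -> (V -> V) -> V -> R.

Definition is_3form (w : tensor3) : Prop :=
  [/\ forall X Y Z, smooth X -> smooth Y -> smooth Z -> smooth (w X Y Z),
      forall X X' Y Z, smooth X -> smooth X' -> smooth Y -> smooth Z ->
        forall p, w (fun q => X q + X' q) Y Z p = w X Y Z p + w X' Y Z p,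
      forall (f : V -> R) X Y Z, smooth f -> smooth X -> smooth Y -> smooth Z ->
        forall p, w (fun q => f q *: X q) Y Z p = f p * w X Y Z p,
      forall X Y Z, smooth X -> smooth Y -> smooth Z ->
        forall p, w Y X Z p = - w X Y Z p
    & forall X Y Z, smooth X -> smooth Y -> smooth Z ->
        forall p, w X Z Y p = - w X Y Z p].

Definition nabla2 (D : connection) (w : tensor2) (W X Y : V -> V) : V -> R :=
  fun p => 'D_(W p) (w X Y) p - w (D W X) Y p - w X (D W Y) p.

Definition nabla3 (D : connection) (w : tensor3) (W X Y Z : V -> V) : V -> R :=
  fun p => 'D_(W p) (w X Y Z) p
           - w (D W X) Y Z p - w X (D W Y) Z p - w X Y (D W Z) p.

Definition nabla_end (D : connection) (J : (V -> V) -> (V -> V))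
    (W X : V -> V) : V -> V :=
  fun p => D W (J X) p - J (D W X) p.

Definition parallel2 (D : connection) (w : tensor2) : Prop :=
  forall W X Y, smooth W -> smooth X -> smooth Y ->
  forall p, nabla2 D w W X Y p = 0.

Definition parallel3 (D : connection) (w : tensor3) : Prop :=
  forall W X Y Z, smooth W -> smooth X -> smooth Y -> smooth Z ->
  forall p, nabla3 D w W X Y Z p = 0.

Definition parallel_end (D : connection) (J : (V -> V) -> (V -> V)) : Prop :=
  forall W X, smooth W -> smooth X -> forall p, nabla_end D J W X p = 0.

End Fields.

Section HKT.
Variable R : realType.
Local Notation V := 'rV[R]_8.

(* The entry [jr a b s] stands for J_i e_a = s e_b and J_i e_(a+4) = s e_(b+4).
   [Je1], [Je5], [JJ], [J1J2] and [J2J1] below are the relations that determine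
   the J_i. *)
Definition jr (a b : nat) (s : int) : nat * nat * int := (a, b, s).
Definition Jtable (i : nat) : seq (nat * nat * int) :=
  match i with
  | 1 => [:: jr 1 2 1; jr 2 1 (-1); jr 3 4 1; jr 4 3 (-1)]
  | 2 => [:: jr 1 3 1; jr 3 1 (-1); jr 2 4 (-1); jr 4 2 1]
  | 3 => [:: jr 1 4 1; jr 4 1 (-1); jr 2 3 1; jr 3 2 (-1)]
  | _ => [::]
  end%N.

Definition J (i : nat) (x : V) : V :=
  \sum_(t <- Jtable i) let: (a, b, s) := t in
    s%:~R *: (co a x *: e R b + co a.+4 x *: e R b.+4).

(* The inner product for which e_1, ..., e_8 is orthonormal. *)
Definition ip (x y : V) : R := \sum_(1 <= k < 9) co k x * co k y.

Variable n : brackets.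

Definition metric : tensor2 R :=
  fun X Y p => ip (to_unit n p (X p)) (to_unit n p (Y p)).

Definition Jfield (i : nat) (X : V -> V) : V -> V :=
  fun p => from_unit n p (J i (to_unit n p (X p))).

Definition torsion_form (D : connection R) : tensor3 R :=
  fun X Y Z => metric X (torsion D Y Z).

Definition is_bismut (D : connection R) : Prop :=
  [/\ is_connection D,
      parallel2 D metric,
      forall i : nat, (1 <= i <= 3)%N -> parallel_end D (Jfield i)
    & is_3form (torsion_form D)].

End HKT.

Section Checks.
Variable R : realType.
Local Notation V := 'rV[R]_8.

Lemma co_e (j k : nat) : (1 <= j <= 8)%N -> (1 <= k <= 8)%N ->
  co j (e R k) = (j == k)%:R.
Proof.
case: j k => [|j] [|k] //= hj hk.
by rewrite /co mxE eqxx -val_eqE /= !inordK.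
Qed.

Lemma coD k (x y : V) : co k (x + y) = co k x + co k y.
Proof. by rewrite /co mxE. Qed.

Lemma coZ k (a : R) (x : V) : co k (a *: x) = a * co k x.
Proof. by rewrite /co mxE. Qed.

Lemma coN k (x : V) : co k (- x) = - co k x.
Proof. by rewrite /co mxE. Qed.

Lemma co_inj (x y : V) :
  (forall k, (1 <= k <= 8)%N -> co k x = co k y) -> x = y.
Proof.
move=> h; apply/rowP => i; have := h i.+1; rewrite /co /= inord_val.
by apply; rewrite ltn_ord.
Qed.


Lemma J_linear i : linear (@J R i).
Proof.
move=> a x y; rewrite /J scaler_sumr -big_split; apply: eq_bigr => -[[b c] s] _.
rewrite /= !coD !coZ scalerA [a * s%:~R]mulrC -scalerA -scalerDr; congr (_ *: _).
by rewrite !scalerDr !scalerDl -!scalerA addrACA.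
Qed.

Lemma co0 k : co k (0 : V) = 0.
Proof. by rewrite /co mxE. Qed.

Lemma co_sum (T : Type) (r : seq T) (F : T -> V) k :
  co k (\sum_(t <- r) F t) = \sum_(t <- r) co k (F t).
Proof. by rewrite /co summxE. Qed.

Lemma co_J k i (x : V) : (1 <= k <= 8)%N ->
  co k (J i x) = \sum_(t <- Jtable i) let: (a, b, s) := t in
    s%:~R * (co a x * (k == b)%:R + co a.+4 x * (k == b.+4)%:R).
Proof.
move=> hk; rewrite co_sum; apply: eq_big_seq => -[[a b] s].
case: i => [|[|[|[|i]]]] //; rewrite !inE => /or4P[] /eqP[-> -> ->];
  by rewrite coZ coD !coZ !co_e.
Qed.

Lemma co_lie (n : brackets) k (x y : V) : n \in [:: n1; n2; n3] ->
  (1 <= k <= 8)%N ->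
  co k (lie n x y) = \sum_(t <- n) let: (i, j, l, s) := t in
    (s%:~R * (co i x * co j y - co j x * co i y)) * (k == l)%:R.
Proof.
move=> hn hk; rewrite co_sum.
apply: eq_big_seq => -[[[i j] l] s] ht; rewrite coZ co_e //.
move: hn ht; rewrite !inE => /or3P[] /eqP->; rewrite !inE;
  by move=> ht; repeat (case/orP: ht => [/eqP[_ _ -> _] //|ht]);
     move/eqP: ht => [_ _ -> _].
Qed.

Ltac coords := let k := fresh "k" in let hk := fresh "hk" in
  apply: co_inj => k hk; rewrite ?coN ?co0;
  do ?[rewrite ?co_J ?co_lie ?co_e // ?big_cons ?big_nil /=]; ring.

Lemma Je1 i : (1 <= i <= 3)%N -> J i (e R 1) = e R i.+1.
Proof. by case: i => [|[|[|[|i]]]] // _; coords. Qed.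

Lemma Je5 i : (1 <= i <= 3)%N -> J i (e R 5) = e R (5 + i).
Proof. by case: i => [|[|[|[|i]]]] // _; coords. Qed.

Lemma JJ i (x : V) : (1 <= i <= 3)%N -> J i (J i x) = - x.
Proof.
case: i => [|[|[|[|i]]]] // _; apply: co_inj => k hk; rewrite coN;
  do 2 rewrite !co_J // !big_cons !big_nil /=;
  by do 9? [case: k hk => [|k] // hk]; rewrite /=; ring.
Qed.

Lemma J1J2 (x : V) : J 1 (J 2 x) = J 3 x.
Proof. by coords. Qed.

Lemma J2J1 (x : V) : J 2 (J 1 x) = - J 3 x.
Proof. by coords. Qed.

Lemma lie_J (n : brackets) i (x y : V) : n \in [:: n1; n2; n3] ->
  (1 <= i <= 3)%N -> lie n (J i x) (J i y) = lie n x y.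
Proof.
move=> hn hi; apply: co_inj => k hk; rewrite !co_lie //.
move: hn; rewrite !inE => /or3P[] /eqP->; case: i hi => [|[|[|[|i]]]] // _;
  by rewrite !big_cons !big_nil /= !co_J // !big_cons !big_nil /=; ring.
Qed.

Lemma lie2step (n : brackets) (x y z : V) : n \in [:: n1; n2; n3] ->
  lie n x (lie n y z) = 0.
Proof.
move=> hn; apply: co_inj => k hk; rewrite co0 !co_lie //.
move: (hn); rewrite !inE => /or3P[] /eqP en; rewrite en in hn *;
  by rewrite !big_cons !big_nil /= !co_lie // !big_cons !big_nil /=; ring.
Qed.

Lemma lieC (n : brackets) (x y : V) : lie n y x = - lie n x y.
Proof.
rewrite /lie -sumrN; apply: eq_bigr => -[[[i j] k] s] _.
by rewrite /= -[RHS]scaleNr; congr (_ *: _); ring.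
Qed.

Lemma lie_is_linear (n : brackets) (x : V) : linear (@lie R n x).
Proof.
move=> a y z; rewrite /lie scaler_sumr -big_split.
apply: eq_bigr => -[[[i j] k] s] _; rewrite /= !coD !coZ scalerA -scalerDl.
by congr (_ *: _); ring.
Qed.

HB.instance Definition _ (n : brackets) (x : V) :=
  GRing.isLinear.Build R V V _ (@lie R n x) (lie_is_linear n x).

Lemma lieDl (n : brackets) (x y z : V) :
  lie n (x + y) z = lie n x z + lie n y z.
Proof. by rewrite ![lie n _ z]lieC linearD opprD. Qed.

Lemma lieZl (n : brackets) a (x z : V) : lie n (a *: x) z = a *: lie n x z.
Proof. by rewrite ![lie n _ z]lieC linearZ scalerN. Qed.

Lemma liexx (n : brackets) (x : V) : lie n x x = 0.
Proof. by rewrite /lie big1 // => -[[[i j] k] s] _ /=; rewrite [co j x * _]mulrC subrr mulr0 scale0r. Qed.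

Lemma gmulA (n : brackets) (x y z : V) : n \in [:: n1; n2; n3] ->
  gmul n x (gmul n y z) = gmul n (gmul n x y) z.
Proof.
move=> hn; rewrite /gmul !linearD !linearZ /= !lieDl !lieZl.
rewrite [lie n (lie _ _ _) _]lieC !lie2step // oppr0 !scaler0 !addr0.
by rewrite !scalerDr; apply/rowP => k; rewrite !mxE; ring.
Qed.

Lemma gmulV (n : brackets) (x : V) : gmul n x (ginv x) = 0.
Proof. by rewrite /gmul /ginv subrr linearN /= liexx oppr0 scaler0 addr0. Qed.

Lemma gmul0 (n : brackets) (x : V) : gmul n 0 x = x /\ gmul n x 0 = x.
Proof.
split; first by rewrite /gmul add0r lieC linear0 oppr0 scaler0 addr0.
by rewrite /gmul addr0 linear0 scaler0 addr0.
Qed.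

Lemma derive_affine (f : V -> V) (q v w : V) :
  (forall h : R, f (h *: v + q) = f q + h *: w) -> 'D_v f q = w.
Proof.
move=> hf; apply: cvg_lim => //; apply: cvg_near_cst; near=> h.
rewrite /= hf addrC addKr scalerA mulVf ?scale1r //.
by near: h; exact: nbhs_dnbhs_neq.
Unshelve. all: by end_near. Qed.

Lemma dleftE (n : brackets) (p q v : V) :
  dleft n p q v = v + 2^-1 *: lie n p v.
Proof.
apply: derive_affine => h; rewrite /gmul linearD linearZ /=.
by apply/rowP => k; rewrite !mxE; ring.
Qed.

Lemma to_unitK (n : brackets) (p v : V) : n \in [:: n1; n2; n3] ->
  to_unit n p (from_unit n p v) = v.
Proof.
move=> hn; rewrite /to_unit /from_unit !dleftE /ginv -scaleN1r lieZl.
rewrite ![lie n p (_ + _)]linearD /= [lie n p (_ *: _)]linearZ /= lie2step // !scaler0 addr0 scaleN1r.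
by apply/rowP => k; rewrite !mxE; ring.
Qed.

(* The left-invariant vector fields form the Lie algebra (R^8, lie n). *)
Lemma lie_bracket_from_unit (n : brackets) (v w : V) :
  n \in [:: n1; n2; n3] -> forall p,
  lie_bracket (fun q => from_unit n q v) (fun q => from_unit n q w) p =
  from_unit n p (lie n v w).
Proof.
move=> hn p; rewrite /lie_bracket.
have D u x : 'D_u (fun q => from_unit n q x) p = 2^-1 *: lie n u x.
  apply: derive_affine => h; rewrite /from_unit !dleftE lieDl lieZl.
  by apply/rowP => k; rewrite !mxE; ring.
rewrite !D /from_unit !dleftE !lieDl !lieZl.
have lie0 x y z : lie n (lie n x y) z = 0 :> V.
  by rewrite lieC lie2step // oppr0.
rewrite !lie0 lie2step // [lie n w v]lieC.
by apply/rowP => k; rewrite !mxE; field.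
Qed.

End Checks.

(* Main.v *)
From HB Require Import structures.
Require Import Defs.
From mathcomp Require Import all_boot all_order all_algebra.
From mathcomp Require Import all_classical all_reals all_analysis.
From mathcomp Require Import ring.

Set Implicit Arguments.
Unset Strict Implicit.
Unset Printing Implicit Defensive.

Import Order.TTheory GRing.Theory Num.Theory.
Import numFieldNormedType.Exports.
Local Open Scope ring_scope.

(** In the left-invariant frame a vector field X becomes a function
    theta X : R^8 -> R^8 ([coframe]), the metric becomes the fixed inner product
    <x, y>, the J_i become the fixed endomorphisms [J i], and the Lie bracket is
    given by the Maurer-Cartan equation ([maurer_cartan]).

    Existence.  Since [J_i x, J_i y] = [x, y], the Bismut connection is
      theta (D_X Y) = X(theta Y) + Gamma (theta X) (theta Y),
    where <Gamma w x, y> = - <w, [x, y]> ([christoffel]).  This Gamma w is skew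
    and commutes with the J_i, and the torsion 3-form is minus the cyclic sum of
    <x, [y, z]> ([torsion3]); see [bismut_is_bismut].

    Uniqueness.  Let A(X, Y, Z) be the metric product with Z of the difference
    of two Bismut connections applied to X, Y.  Compatibility with the metric
    and skew torsion make A cyclic; compatibility with J makes A invariant under
    J on any two of its arguments.  Hence A(X, Y, Z) = A(JX, JY, Z)
    = - A(JX, Y, JZ) = - A(X, Y, Z), and A vanishes ([skew_torsion_J_eq0],
    [bismut_unique]).

    Parallelism.  The components of the torsion form in the invariant frame are
    constant, so its covariant derivative is minus the derivation action of
    Gamma w on [torsion3], namely [torsion3_act].  As the algebra is 2-step
    nilpotent, this action is the cyclic sum over x, y, z of
    <Gamma y z - Gamma z y, Gamma w x> ([torsion3_actE]).  On n1 each Gamma y is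
    a multiple y_5 K of one skew map K that is isometric on the span of
    e_1, ..., e_4, and the sum cancels.  On n2 and n3 the maps Gamma e_6 and
    Gamma e_7 are not proportional and the sum survives: it is 2 at w = e_6,
    (x, y, z) = (e_1, e_2, e_7). *)

(** * Calculus of smooth maps *)

Section Calculus.
Variable R : realType.
Local Notation V := 'rV[R]_8.

Lemma derive_dirD (W : normedModType R) (f : V -> W) p u v :
  differentiable f p -> 'D_(u + v) f p = 'D_u f p + 'D_v f p.
Proof. by move=> df; rewrite !deriveE // linearD. Qed.

Lemma derive_dirZ (W : normedModType R) (f : V -> W) p a v :
  differentiable f p -> 'D_(a *: v) f p = a *: 'D_v f p.
Proof. by move=> df; rewrite !deriveE // linearZ. Qed.

Lemma derive_add (W : normedModType R) (f g : V -> W) p v :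
  differentiable f p -> differentiable g p ->
  'D_v (fun q => f q + g q) p = 'D_v f p + 'D_v g p.
Proof. by move=> df dg; rewrite -deriveD //; exact: diff_derivable. Qed.

Lemma rV_linear_continuous m (W : normedModType R)
  (f : {linear 'rV[R]_m.+1 -> W}) : continuous f.
Proof.
have -> : f = (fun x => \sum_(i < m.+1) x 0 i *: f (delta_mx 0 i)) :> (_ -> _).
  apply/funext => x; rewrite {1}[x]row_sum_delta linear_sum.
  by apply: eq_bigr => i _; rewrite linearZ.
have addc : continuous (fun z : W * W => z.1 + z.2) by exact: add_continuous.
apply: (continuous_big addc) => i _ x.
apply: (@continuous_comp _ _ _ (fun x : 'rV[R]_m.+1 => x 0 i) ( *:%R^~ _)).
  exact: coord_continuous.
exact: scalel_continuous.
Qed.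

Lemma rV_bilinear_continuous l m (W : normedModType R)
  (B : {bilinear 'rV[R]_l.+1 -> 'rV[R]_m.+1 -> W}) :
  continuous (fun x => B x.1 x.2).
Proof.
have -> : (fun x => B x.1 x.2) = (fun x => \sum_(i < l.+1) \sum_(j < m.+1)
    (x.1 0 i * x.2 0 j) *: B (delta_mx 0 i) (delta_mx 0 j)).
  apply/funext => -[x y] /=; rewrite {1}[x]row_sum_delta linear_sumlz.
  apply: eq_bigr => i _; rewrite linearZl_LR {1}[y]row_sum_delta linear_sumr.
  by rewrite scaler_sumr; apply: eq_bigr => j _; rewrite linearZr_LR scalerA.
have addc : continuous (fun z : W * W => z.1 + z.2) by exact: add_continuous.
apply: (continuous_big addc) => i _; apply: (continuous_big addc) => j _ x.
apply: (@continuous_comp _ _ _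
  (fun x : 'rV[R]_l.+1 * 'rV[R]_m.+1 => x.1 0 i * x.2 0 j) ( *:%R^~ _)).
  apply: continuousM.
    exact: (continuous_comp cvg_fst (@coord_continuous R 1 l.+1 0 i x.1)).
  exact: (continuous_comp cvg_snd (@coord_continuous R 1 m.+1 0 j x.2)).
exact: scalel_continuous.
Qed.

Section Bilinear.
Variables (U U' W : normedModType R) (B : {bilinear U -> U' -> W}).
Hypothesis Bc : continuous (fun x => B x.1 x.2).

Lemma differentiable_bilinear (F : V -> U) (G : V -> U') p :
  differentiable F p -> differentiable G p ->
  differentiable (fun q => B (F q) (G q)) p.
Proof.
move=> dF dG.
apply: (@differentiable_comp _ _ _ _ (fun q => (F q, G q))
  (fun x => B x.1 x.2)).
  exact: differentiable_pair.
exact: differentiable_bilin.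
Qed.

Lemma derive_bilinear (F : V -> U) (G : V -> U') p v :
  differentiable F p -> differentiable G p ->
  'D_v (fun q => B (F q) (G q)) p = B ('D_v F p) (G p) + B (F p) ('D_v G p).
Proof.
move=> dF dG; rewrite deriveE; last exact: differentiable_bilinear.
rewrite (@diff_comp _ _ _ _ (fun q => (F q, G q)) (fun x => B x.1 x.2)).
- by rewrite diff_bilin // diff_pair //= addrC !deriveE.
- exact: differentiable_pair.
- exact: differentiable_bilin.
Qed.

End Bilinear.

Lemma smooth_differentiable (W : normedModType R) (f : V -> W) p :
  smooth f -> differentiable f p.
Proof. by move=> /(_ [::]). Qed.

Lemma smooth_derive (W : normedModType R) (f : V -> W) v :
  smooth f -> smooth (fun q => 'D_v f q).
Proof. by move=> sf vs; exact: sf (v :: vs). Qed.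

(** Smoothness is the largest class of differentiable maps stable under all
    directional derivatives; closure properties are proved by exhibiting such a
    class. *)
Lemma smooth_coind (W : normedModType R) (P : (V -> W) -> Prop) :
  (forall f, P f -> (forall p, differentiable f p) /\
    forall v, P (fun q => 'D_v f q)) ->
  forall f, P f -> smooth f.
Proof.
move=> step f Pf vs; elim: vs f Pf => [|v vs IH] f /step[df Df] p.
  exact: df.
exact: IH.
Qed.

Lemma smooth_cst (W : normedModType R) (a : W) : smooth (fun _ : V => a).
Proof.
apply: (@smooth_coind _ (fun f => exists b, f = fun=> b)); last by exists a.
move=> _ [b ->]; split=> [p|v]; first exact: differentiable_cst.
by exists 0; apply/funext => q; rewrite derive_cst.
Qed.

Lemma smooth_add (W : normedModType R) (f g : V -> W) :
  smooth f -> smooth g -> smooth (fun q => f q + g q).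
Proof.
move=> sf sg; apply: (@smooth_coind _ (fun h => exists f g,
  [/\ smooth f, smooth g & h = fun q => f q + g q])); last by exists f, g.
move=> {sf sg} _ {f g} [f [g [sf sg ->]]]; split=> [p|v].
  by apply: differentiableD; exact: smooth_differentiable.
exists (fun q => 'D_v f q), (fun q => 'D_v g q).
split; [exact: smooth_derive.. |].
by apply/funext => q; apply: derive_add; exact: smooth_differentiable.
Qed.

Lemma smooth_sum (W : normedModType R) (I : Type) (r : seq I)
    (F : I -> V -> W) :
  (forall i, smooth (F i)) -> smooth (fun q => \sum_(i <- r) F i q).
Proof.
move=> sF; elim: r => [|i r IH].
  under [X in smooth X]funext do rewrite big_nil; exact: smooth_cst.
under [X in smooth X]funext do rewrite big_cons; exact: smooth_add.
Qed.

(** The Leibniz rule turns one term B(F, G) into two, so the maps to which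
    [smooth_coind] applies are the finite sums of such terms. *)
Inductive bilinear_sum (U U' W : normedModType R)
    (B : {bilinear U -> U' -> W}) : (V -> W) -> Prop :=
| BilinearTerm F G : smooth F -> smooth G ->
    bilinear_sum B (fun q => B (F q) (G q))
| BilinearAdd f g : bilinear_sum B f -> bilinear_sum B g ->
    bilinear_sum B (fun q => f q + g q).

Lemma smooth_bilinear (U U' W : normedModType R) (B : {bilinear U -> U' -> W})
    (F : V -> U) (G : V -> U') :
  continuous (fun x => B x.1 x.2) -> smooth F -> smooth G ->
  smooth (fun q => B (F q) (G q)).
Proof.
move=> Bc sF sG; apply: (@smooth_coind _ (bilinear_sum B)); last first.
  exact: BilinearTerm.
move=> {F G sF sG} f; elim=> {f} [F G sF sG|f g _ [df Df] _ [dg Dg]].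
  have dF p := smooth_differentiable p sF.
  have dG p := smooth_differentiable p sG.
  split=> [p|v]; first exact: differentiable_bilinear.
  under [X in bilinear_sum _ X]funext do rewrite derive_bilinear //.
  by apply: BilinearAdd; apply: BilinearTerm => //; exact: smooth_derive.
split=> [p|v]; first exact: differentiableD.
under [X in bilinear_sum _ X]funext do rewrite derive_add //.
exact: BilinearAdd.
Qed.

Lemma derive_linear m (W : normedModType R) (L : {linear 'rV[R]_m.+1 -> W})
    (F : V -> 'rV[R]_m.+1) p v :
  differentiable F p -> 'D_v (fun q => L (F q)) p = L ('D_v F p).
Proof.
move=> dF; have Lc : continuous L by exact: rV_linear_continuous.
have dL q : differentiable L q by exact: linear_differentiable.
rewrite deriveE; last exact: (differentiable_comp dF).
by rewrite (@diff_comp _ _ _ _ F L) //= (diff_lin _ Lc) deriveE.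
Qed.

Lemma smooth_linear m (W : normedModType R) (L : {linear 'rV[R]_m.+1 -> W})
    (F : V -> 'rV[R]_m.+1) :
  smooth F -> smooth (fun q => L (F q)).
Proof.
move=> sF; apply: (@smooth_coind _ (fun h => exists2 F, smooth F &
  h = fun q => L (F q))); last by exists F.
move=> {F sF} _ [F sF ->]; have dF p := smooth_differentiable p sF.
split=> [p|v].
  by apply: differentiable_comp => //; apply: linear_differentiable;
    exact: rV_linear_continuous.
exists (fun q => 'D_v F q); first exact: smooth_derive.
by apply/funext => q; rewrite derive_linear.
Qed.

Lemma scale_is_bilinear (W : normedModType R) : bilinear_for
  (GRing.Scale.Law.clone _ _ *:%R _) (GRing.Scale.Law.clone _ _ *:%R _)
  (@GRing.scale R W : R -> W -> W).
Proof.
split=> [w|a] b x y /=; first by rewrite scalerDl scalerA.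
by rewrite scalerDr !scalerA mulrC.
Qed.

HB.instance Definition _ (W : normedModType R) :=
  bilinear_isBilinear.Build R R W W _ _
    (@GRing.scale R W : R -> W -> W) (@scale_is_bilinear W).

Lemma smooth_scale (W : normedModType R) (f : V -> R) (g : V -> W) :
  smooth f -> smooth g -> smooth (fun q => f q *: g q).
Proof. exact/smooth_bilinear/scale_continuous. Qed.

Lemma derive_scale (W : normedModType R) (f : V -> R) (g : V -> W) p v :
  differentiable f p -> differentiable g p ->
  'D_v (fun q => f q *: g q) p = 'D_v f p *: g p + f p *: 'D_v g p.
Proof. exact/derive_bilinear/scale_continuous. Qed.

Lemma smooth_id : smooth (id : V -> V).
Proof.
apply: (@smooth_coind _ (fun f => f = id \/ exists b, f = fun=> b)).
  2: by left.
move=> _ [->|[b ->]]; split=> [p|v].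
- by apply: (@linear_differentiable _ _ _ idfun) => ?; exact.
- by right; exists v; apply/funext => q; rewrite derive_id.
- exact: differentiable_cst.
- by right; exists 0; apply/funext => q; rewrite derive_cst.
Qed.

Lemma smooth_coord (X : V -> V) i : smooth X -> smooth (fun q => X q 0 i).
Proof.
have coord_linear : linear (fun x : V => x 0 i) by move=> a x y; rewrite !mxE.
pose L : {linear V -> R} := HB.pack (fun x : V => x 0 i)
  (GRing.isLinear.Build _ _ _ _ _ coord_linear).
exact: (@smooth_linear _ _ L).
Qed.

(** The direction varies with the point, so the derivative is expanded over the
    constant directions of the standard basis. *)
Lemma smooth_derive_along (W : normedModType R) (X : V -> V) (f : V -> W) :
  smooth X -> smooth f -> smooth (fun q => 'D_(X q) f q).
Proof.
move=> sX sf; have df p := smooth_differentiable p sf.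
rewrite (_ : (fun q => _) =
  (fun q => \sum_(i < 8) X q 0 i *: 'D_(delta_mx 0 i) f q)); last first.
  apply/funext => q; rewrite deriveE // {1}[X q]row_sum_delta linear_sum.
  by apply: eq_bigr => i _; rewrite linearZ deriveE.
apply: smooth_sum => i; apply: smooth_scale; first exact: smooth_coord.
exact: smooth_derive.
Qed.

Lemma smooth_rV_bilinear (W : normedModType R) (B : {bilinear V -> V -> W})
    (X Y : V -> V) :
  smooth X -> smooth Y -> smooth (fun q => B (X q) (Y q)).
Proof. by apply: smooth_bilinear; exact: rV_bilinear_continuous. Qed.

Lemma derive_rV_bilinear (W : normedModType R) (B : {bilinear V -> V -> W})
    (X Y : V -> V) p v :
  differentiable X p -> differentiable Y p ->
  'D_v (fun q => B (X q) (Y q)) p = B ('D_v X p) (Y p) + B (X p) ('D_v Y p).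
Proof. by apply: derive_bilinear; exact: rV_bilinear_continuous. Qed.

End Calculus.

(** * The invariant connection at the level of the Lie algebra *)

Section Algebra.
Variable R : realType.
Local Notation V := 'rV[R]_8.

Lemma ipE (x y : V) : ip x y = \sum_(k < 8) x 0 k * y 0 k.
Proof.
rewrite /ip big_add1 big_mkord; apply: eq_bigr => k _.
by rewrite /co /= inord_val.
Qed.

Lemma ip_is_bilinear : bilinear_for
  (GRing.Scale.Law.clone _ _ *:%R _) (GRing.Scale.Law.clone _ _ *:%R _)
  (@ip R).
Proof.
split=> [y|x] a u v /=; rewrite !ipE scaler_sumr -big_split;
  by apply: eq_bigr => k _; rewrite !mxE /= /GRing.scale /=; ring.
Qed.

HB.instance Definition _ :=
  bilinear_isBilinear.Build R V V R _ _ (@ip R) ip_is_bilinear.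

Lemma ipPl a (x y z : V) : ip (a *: x + y) z = a * ip x z + ip y z.
Proof. exact: linearPl. Qed.

Lemma ipPr a (x y z : V) : ip x (a *: y + z) = a * ip x y + ip x z.
Proof. exact: linearPr. Qed.

Lemma ipDl (x y z : V) : ip (x + y) z = ip x z + ip y z.
Proof. exact: linearDl. Qed.

Lemma ipDr (x y z : V) : ip x (y + z) = ip x y + ip x z.
Proof. exact: linearDr. Qed.

Lemma ipZl a (x y : V) : ip (a *: x) y = a * ip x y.
Proof. exact: linearZl_LR. Qed.

Lemma ipZr a (x y : V) : ip x (a *: y) = a * ip x y.
Proof. exact: linearZr_LR. Qed.

Lemma ipNr (x y : V) : ip x (- y) = - ip x y.
Proof. exact: linearNr. Qed.

Lemma ipBr (x y z : V) : ip x (y - z) = ip x y - ip x z.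
Proof. exact: linearBr. Qed.

Lemma ipC (x y : V) : ip x y = ip y x.
Proof. by rewrite !ipE; apply: eq_bigr => k _; rewrite mulrC. Qed.

Lemma ip_delta (x : V) k : ip x (delta_mx 0 k) = x 0 k.
Proof.
rewrite ipE (bigD1 k) //= mxE !eqxx mulr1 big1 ?addr0 // => i ik.
by rewrite mxE (negbTE ik) andbF mulr0.
Qed.

Lemma ip_inj (x y : V) : (forall z, ip x z = ip y z) -> x = y.
Proof. by move=> h; apply/rowP => k; rewrite -!ip_delta. Qed.

HB.instance Definition _ i :=
  GRing.isLinear.Build R V V _ (@J R i) (@J_linear R i).

Lemma ip_J i (x y : V) : (1 <= i <= 3)%N -> ip (J i x) y = - ip x (J i y).
Proof.
move=> hi; rewrite /ip unlock /= !addr0.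
case: i hi => [|[|[|[|i]]]] // _;
  by rewrite !co_J // !big_cons !big_nil /=; ring.
Qed.

Section LieAlgebra.
Variable n : brackets.
Hypothesis hn : n \in [:: n1; n2; n3].

Lemma lie_is_bilinear : bilinear_for
  (GRing.Scale.Law.clone _ _ *:%R _) (GRing.Scale.Law.clone _ _ *:%R _)
  (@lie R n).
Proof.
split=> [y|x] a u v /=; first by rewrite lieDl lieZl.
exact: lie_is_linear.
Qed.

HB.instance Definition _ :=
  bilinear_isBilinear.Build R V V V _ _ (@lie R n) lie_is_bilinear.

Lemma lieDr (x y z : V) : lie n x (y + z) = lie n x y + lie n x z.
Proof. exact: linearDr. Qed.

Lemma lieZr a (x y : V) : lie n x (a *: y) = a *: lie n x y.
Proof. exact: linearZr_LR. Qed.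

(** The bracket is invariant under J, and J^2 = - 1. *)
Lemma lie_Jl i (x y : V) : (1 <= i <= 3)%N ->
  lie n (J i x) y = - lie n x (J i y).
Proof. by move=> hi; rewrite -(lie_J x (J i y) hn hi) JJ // linearN opprK. Qed.

(** The map Gamma of the Bismut connection on left-invariant fields, i.e. minus
    the transpose of ad x applied to w: see [ip_christoffel]. *)
Definition christoffel (w x : V) : V := \row_k - ip w (lie n x (delta_mx 0 k)).

Lemma ip_christoffel (w x y : V) : ip (christoffel w x) y = - ip w (lie n x y).
Proof.
rewrite {2}[y]row_sum_delta [lie n x _]linear_sumr [ip w _]linear_sumr.
rewrite ipE -sumrN.
by apply: eq_bigr => k _; rewrite !linearZr_LR !mxE /= /GRing.scale /=; ring.
Qed.

Lemma christoffel_is_bilinear : bilinear_for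
  (GRing.Scale.Law.clone _ _ *:%R _) (GRing.Scale.Law.clone _ _ *:%R _)
  christoffel.
Proof.
split=> [x|w] a u v /=; apply: ip_inj => z; rewrite ipPl !ip_christoffel.
  by rewrite ipPl opprD mulrN.
by rewrite lieDl lieZl ipPr opprD mulrN.
Qed.

HB.instance Definition _ :=
  bilinear_isBilinear.Build R V V V _ _ christoffel christoffel_is_bilinear.

Lemma christoffel_skew (w x y : V) :
  ip (christoffel w x) y = - ip x (christoffel w y).
Proof. by rewrite [ip x _]ipC !ip_christoffel lieC ipNr. Qed.

Lemma christoffel_J i (w x : V) : (1 <= i <= 3)%N ->
  christoffel w (J i x) = J i (christoffel w x).
Proof.
move=> hi; apply: ip_inj => z.
by rewrite ip_J // !ip_christoffel lie_Jl // ipNr.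
Qed.

(** The torsion 3-form in the left-invariant frame. *)
Definition torsion3 (x y z : V) : R :=
  - (ip x (lie n y z) + ip y (lie n z x) + ip z (lie n x y)).

Lemma torsion3_christoffel (x y z : V) :
  ip x (christoffel y z - christoffel z y - lie n y z) = torsion3 x y z.
Proof.
rewrite !ipBr ![ip x (christoffel _ _)]ipC !ip_christoffel /torsion3.
by rewrite [lie n y x]lieC ipNr; ring.
Qed.

Lemma torsion3_swap12 (x y z : V) : torsion3 y x z = - torsion3 x y z.
Proof.
rewrite /torsion3 [lie n x z]lieC [lie n z y]lieC [lie n y x]lieC !ipNr.
by ring.
Qed.

Lemma torsion3_swap23 (x y z : V) : torsion3 x z y = - torsion3 x y z.
Proof.
rewrite /torsion3 [lie n x z]lieC [lie n z y]lieC [lie n y x]lieC !ipNr.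
by ring.
Qed.

Lemma torsion3Z1 a (x y z : V) : torsion3 (a *: x) y z = a * torsion3 x y z.
Proof.
by rewrite /torsion3 lieZl lieZr ipZl !ipZr; ring.
Qed.

Lemma torsion3D1 (x x' y z : V) :
  torsion3 (x + x') y z = torsion3 x y z + torsion3 x' y z.
Proof.
by rewrite /torsion3 lieDl lieDr ipDl !ipDr; ring.
Qed.

Lemma torsion3D2 (x y y' z : V) :
  torsion3 x (y + y') z = torsion3 x y z + torsion3 x y' z.
Proof. by rewrite torsion3_swap12 torsion3D1 opprD -!torsion3_swap12. Qed.

Lemma torsion3D3 (x y z z' : V) :
  torsion3 x y (z + z') = torsion3 x y z + torsion3 x y z'.
Proof. by rewrite torsion3_swap23 torsion3D2 opprD -!torsion3_swap23. Qed.

(** The endomorphism Gamma w acting on [torsion3] as a derivation. *)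
Definition torsion3_act (w x y z : V) : R :=
  torsion3 (christoffel w x) y z + torsion3 x (christoffel w y) z
    + torsion3 x y (christoffel w z).

(** In [torsion3 (Gamma w u) v t] the term
    <Gamma w u, [v, t]> = - <w, [u, [v, t]]> vanishes by 2-step nilpotency, and
    the two others are rewritten with the defining property of Gamma. *)
Lemma torsion3_actE (w x y z : V) :
  torsion3_act w x y z =
    ip (christoffel y z) (christoffel w x)
    - ip (christoffel z y) (christoffel w x)
    + (ip (christoffel z x) (christoffel w y)
       - ip (christoffel x z) (christoffel w y))
    + (ip (christoffel x y) (christoffel w z)
       - ip (christoffel y x) (christoffel w z)).
Proof.
have act1 u v t : torsion3 (christoffel w u) v t =
    ip (christoffel v t) (christoffel w u)
    - ip (christoffel t v) (christoffel w u).
  rewrite /torsion3 !ip_christoffel lie2step //.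
  by rewrite [lie n (christoffel _ _) _]lieC ipNr [ip w 0]linear0r; ring.
rewrite /torsion3_act act1.
rewrite [torsion3 x _ _]torsion3_swap12 -torsion3_swap23 act1.
by rewrite [torsion3 x y _]torsion3_swap23 torsion3_swap12 opprK act1.
Qed.

Lemma ip_e k (x : V) : ip (e R k) x = co k x.
Proof. by rewrite ipC ip_delta. Qed.

Lemma co_christoffel k (w x : V) :
  co k (christoffel w x) = - ip w (lie n x (e R k)).
Proof. by rewrite -ip_e ipC ip_christoffel. Qed.

Lemma christoffelDl (w w' x : V) :
  christoffel (w + w') x = christoffel w x + christoffel w' x.
Proof. exact: linearDl. Qed.

Lemma christoffelDr (w x x' : V) :
  christoffel w (x + x') = christoffel w x + christoffel w x'.
Proof. exact: linearDr. Qed.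

Lemma christoffelZl a (w x : V) : christoffel (a *: w) x = a *: christoffel w x.
Proof. exact: linearZl_LR. Qed.

Lemma christoffelZr a (w x : V) : christoffel w (a *: x) = a *: christoffel w x.
Proof. exact: linearZr_LR. Qed.

End LieAlgebra.

(** Gamma y = y_5 K, where <K z, x> is minus the e_5-component of [z, x]; K
    permutes e_1, ..., e_4 up to sign and kills the other basis vectors, whence
    <K z, K x> is the inner product of the first four coordinates. *)
Lemma ip_christoffel_n1 (w x y z : V) :
  ip (christoffel n1 y z) (christoffel n1 w x) =
  co 5 y * co 5 w * \sum_(1 <= k < 5) co k z * co k x.
Proof.
have n1P : n1 \in [:: n1; n2; n3] by rewrite inE eqxx.
have ipl (u v t : V) : ip u (lie n1 v t) =
    co 5 u * (co 1 v * co 2 t - co 1 t * co 2 v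
              - (co 3 v * co 4 t - co 3 t * co 4 v)).
  rewrite /ip unlock /= !addr0.
  by rewrite !co_lie // !big_cons !big_nil /=; ring.
rewrite ip_christoffel !ipl !co_christoffel !ipl !co_e // unlock /=.
by ring.
Qed.

(** By [ip_christoffel_n1], <Gamma t u, Gamma w v> is symmetric in u and v, so
    the six terms of [torsion3_actE] cancel in pairs. *)
Lemma torsion3_act_n1 (w x y z : V) : torsion3_act n1 w x y z = 0.
Proof.
have n1P : n1 \in [:: n1; n2; n3] by rewrite inE eqxx.
have sym t u v : ip (christoffel n1 t u) (christoffel n1 w v) =
    ip (christoffel n1 t v) (christoffel n1 w u).
  rewrite !ip_christoffel_n1; congr (_ * _).
  by apply: eq_bigr => k _; rewrite mulrC.
by rewrite torsion3_actE // (sym y z x) (sym z y x) (sym x z y); ring.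
Qed.

(** The components that the brackets of n2 and n3 have in common. *)
Lemma co_lie_n23 (n : brackets) (x y : V) : n \in [:: n2; n3] ->
  [/\ co 1 (lie n x y) = 0, co 2 (lie n x y) = 0,
      co 6 (lie n x y) = co 1 x * co 3 y - co 3 x * co 1 y
                         + (co 2 x * co 4 y - co 4 x * co 2 y)
    & co 7 (lie n x y) = co 1 x * co 4 y - co 4 x * co 1 y
                         - (co 2 x * co 3 y - co 3 x * co 2 y)].
Proof.
move=> hn; have hn' : n \in [:: n1; n2; n3] by rewrite inE hn orbT.
rewrite !co_lie //; move: hn; rewrite !inE => /orP[] /eqP ->;
  by rewrite !big_cons !big_nil /=; split; ring.
Qed.

(** Gamma e_6 maps e_1 to - e_3, e_2 to - e_4 and kills e_7, Gamma e_7 maps e_1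
    to - e_4 and e_2 to e_3, while Gamma e_1 = Gamma e_2 = 0: two of the three
    cyclic terms are equal to 1 and the third is 0. *)
Lemma torsion3_act_n23 (n : brackets) : n \in [:: n2; n3] ->
  torsion3_act n (e R 6) (e R 1) (e R 2) (e R 7) = 2.
Proof.
move=> hn; have hn' : n \in [:: n1; n2; n3] by rewrite inE hn orbT.
have co12 k (x y : V) : (1 <= k <= 2)%N -> co k (lie n x y) = 0.
  by case: (co_lie_n23 x y hn); case: k => [|[|[|k]]].
have co6 (x y : V) : co 6 (lie n x y) = co 1 x * co 3 y - co 3 x * co 1 y
    + (co 2 x * co 4 y - co 4 x * co 2 y) by case: (co_lie_n23 x y hn).
have co7 (x y : V) : co 7 (lie n x y) = co 1 x * co 4 y - co 4 x * co 1 y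
    - (co 2 x * co 3 y - co 3 x * co 2 y) by case: (co_lie_n23 x y hn).
rewrite torsion3_actE // !ip_christoffel.
rewrite !ip_e !(co12 1%N) // !(co12 2%N) //.
rewrite !co7 !co_christoffel !ip_e !co6 !co_e //.
by rewrite /=; ring.
Qed.

End Algebra.

(** * Vector fields in the left-invariant frame *)

(** The Maurer-Cartan form applied to a vector field.  It is locked because
    [to_unit] unfolds to a limit, which unification should never reach. *)
HB.lock Definition coframe (R : realType) (n : brackets)
    (X : 'rV[R]_8 -> 'rV[R]_8) : 'rV[R]_8 -> 'rV[R]_8 :=
  fun p => to_unit n p (X p).

(** The vector field with given components in the left-invariant frame, inverse
    to [coframe]; left-invariant fields are the images of constant maps. *)
HB.lock Definition frame (R : realType) (n : brackets)
    (x : 'rV[R]_8 -> 'rV[R]_8) : 'rV[R]_8 -> 'rV[R]_8 :=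
  fun p => from_unit n p (x p).

Section Frame.
Variables (R : realType) (n : brackets).
Local Notation V := 'rV[R]_8.
Local Notation lie := (@lie R n).
Local Notation coframe := (@coframe R n).
Local Notation frame := (@frame R n).

Lemma coframeE (X : V -> V) : coframe X = fun p => X p - 2^-1 *: lie p (X p).
Proof.
apply/funext => p; rewrite unlock /to_unit dleftE /ginv.
by rewrite -scaleN1r lieZl scaleN1r scalerN.
Qed.

Lemma frameE (x : V -> V) : frame x = fun p => x p + 2^-1 *: lie p (x p).
Proof. by apply/funext => p; rewrite unlock /from_unit dleftE. Qed.

Lemma coframeD (X Y : V -> V) :
  coframe (fun q => X q + Y q) = fun p => coframe X p + coframe Y p.
Proof.
rewrite !coframeE; apply/funext => p; rewrite lieDr.
by apply/rowP => k; rewrite !mxE; ring.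
Qed.

Lemma coframeB (X Y : V -> V) :
  coframe (fun q => X q - Y q) = fun p => coframe X p - coframe Y p.
Proof.
rewrite !coframeE; apply/funext => p; rewrite [lie p _]linearB /=.
by apply/rowP => k; rewrite !mxE; ring.
Qed.

Lemma coframeZ (f : V -> R) (X : V -> V) :
  coframe (fun q => f q *: X q) = fun p => f p *: coframe X p.
Proof.
rewrite !coframeE; apply/funext => p; rewrite lieZr.
by apply/rowP => k; rewrite !mxE; ring.
Qed.

Lemma frameD (x y : V -> V) p :
  frame (fun q => x q + y q) p = frame x p + frame y p.
Proof.
by rewrite !frameE lieDr; apply/rowP => k; rewrite !mxE; ring.
Qed.

Lemma frameB (x y : V -> V) p :
  frame (fun q => x q - y q) p = frame x p - frame y p.
Proof.
by rewrite !frameE [lie p _]linearB /=; apply/rowP => k; rewrite !mxE; ring.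
Qed.

Lemma frameZ a (x : V -> V) p :
  frame (fun q => a *: x q) p = a *: frame x p.
Proof.
by rewrite !frameE lieZr; apply/rowP => k; rewrite !mxE; ring.
Qed.

Lemma frame_val (x y : V -> V) p : x p = y p -> frame x p = frame y p.
Proof. by rewrite !frameE => ->. Qed.

Lemma metricE (X Y : V -> V) :
  metric n X Y = fun p => ip (coframe X p) (coframe Y p).
Proof. by rewrite !unlock. Qed.

Lemma JfieldE i (X : V -> V) :
  Jfield n i X = frame (fun p => J i (coframe X p)).
Proof. by rewrite !unlock. Qed.

Hypothesis hn : n \in [:: n1; n2; n3].

(** The correction that passes from X to its components is central. *)
Lemma lie_shift (p x y : V) : lie x (y - 2^-1 *: lie p y) = lie x y.
Proof. by rewrite [lie x _]linearB /= lieZr lie2step // scaler0 subr0. Qed.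

Lemma frameK (x : V -> V) : coframe (frame x) = x.
Proof.
rewrite coframeE frameE; apply/funext => p.
by rewrite lieDr lieZr lie2step // scaler0 addr0 addrK.
Qed.

Lemma coframeK (X : V -> V) : frame (coframe X) = X.
Proof.
by rewrite frameE coframeE; apply/funext => p; rewrite lie_shift subrK.
Qed.

Lemma smooth_lie (X Y : V -> V) :
  smooth X -> smooth Y -> smooth (fun q => lie (X q) (Y q)).
Proof. exact: (@smooth_rV_bilinear _ _ lie). Qed.

Lemma derive_lie (X Y : V -> V) p v :
  differentiable X p -> differentiable Y p ->
  'D_v (fun q => lie (X q) (Y q)) p =
    lie ('D_v X p) (Y p) + lie (X p) ('D_v Y p).
Proof. exact: (@derive_rV_bilinear _ _ lie). Qed.

Lemma smooth_frame (x : V -> V) : smooth x -> smooth (frame x).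
Proof.
move=> sx; rewrite frameE; apply: smooth_add => //.
apply: smooth_scale; first exact: smooth_cst.
by apply: smooth_lie => //; exact: smooth_id.
Qed.

Lemma smooth_coframe (X : V -> V) : smooth X -> smooth (coframe X).
Proof.
move=> sX; rewrite coframeE; under [X in smooth X]funext do rewrite -scaleNr.
apply: smooth_add => //; apply: smooth_scale; first exact: smooth_cst.
by apply: smooth_lie => //; exact: smooth_id.
Qed.

Lemma differentiable_coframe (X : V -> V) p :
  smooth X -> differentiable (coframe X) p.
Proof. by move=> /smooth_coframe/smooth_differentiable. Qed.

Lemma derive_coframe (X : V -> V) p v : smooth X ->
  'D_v (coframe X) p =
    'D_v X p - 2^-1 *: lie p ('D_v X p) - 2^-1 *: lie v (X p).
Proof.
move=> sX; have dX := smooth_differentiable p sX.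
have sl : smooth (fun q => lie q (X q)).
  by apply: smooth_lie => //; exact: smooth_id.
have dl := smooth_differentiable p sl.
rewrite coframeE deriveB; last 2 first.
- exact: diff_derivable.
- by apply: diff_derivable; exact: differentiableZ.
have -> : 'D_v (fun q => 2^-1 *: lie q (X q)) p =
    2^-1 *: 'D_v (fun q => lie q (X q)) p.
  by apply: deriveZ; exact: diff_derivable.
rewrite (@derive_lie id X) // derive_id scalerDr opprD.
by rewrite addrA addrAC.
Qed.

(** The derivatives of the two correction terms [p, X]/2 and [p, Y]/2 each
    contribute half of the bracket [X, Y]. *)
Lemma maurer_cartan (X Y : V -> V) p : smooth X -> smooth Y ->
  coframe (lie_bracket X Y) p =
    'D_(X p) (coframe Y) p - 'D_(Y p) (coframe X) p
    + lie (coframe X p) (coframe Y p).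
Proof.
move=> sX sY; rewrite (derive_coframe _ _ sX) (derive_coframe _ _ sY).
rewrite (coframeE X) (coframeE Y) lie_shift [lie (X p - _) _]lieC lie_shift.
rewrite [lie (Y p) _]lieC opprK.
rewrite coframeE /lie_bracket [lie p (_ - _)]linearB /=.
move: ('D_(X p) Y p) ('D_(Y p) X p) (lie p ('D_(X p) Y p))
  (lie p ('D_(Y p) X p)) (lie (X p) (Y p)) => a b c d f.
by apply/rowP => k; rewrite !mxE; field.
Qed.

End Frame.

(** * Existence of the Bismut connection *)

Section Bismut.
Variables (R : realType) (n : brackets).
Hypothesis hn : n \in [:: n1; n2; n3].
Local Notation V := 'rV[R]_8.
Local Notation lie := (@lie R n).
Local Notation coframe := (@coframe R n).
Local Notation frame := (@frame R n).

Definition bismut : connection R := fun X Y =>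
  frame (fun p => 'D_(X p) (coframe Y) p
                  + christoffel n (coframe X p) (coframe Y p)).

Lemma coframe_bismut (X Y : V -> V) p : coframe (bismut X Y) p =
  'D_(X p) (coframe Y) p + christoffel n (coframe X p) (coframe Y p).
Proof. by rewrite frameK. Qed.

Lemma smooth_bismut (X Y : V -> V) :
  smooth X -> smooth Y -> smooth (bismut X Y).
Proof.
move=> sX sY; apply: smooth_frame; apply: smooth_add.
  by apply: smooth_derive_along => //; exact: smooth_coframe.
by apply: (@smooth_rV_bilinear _ _ (christoffel n)); exact: smooth_coframe.
Qed.

Lemma bismut_is_connection : is_connection bismut.
Proof.
have dco p (X : V -> V) (sX : smooth X) := differentiable_coframe n p sX.
split=> [X Y|X X' Y sX sX' sY p|f X Y sf sX sY p|X Y Y' sX sY sY' p|].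
- exact: smooth_bismut.
- rewrite /bismut -frameD; apply: frame_val; rewrite coframeD christoffelDl.
  by rewrite (derive_dirD _ _ (dco p Y sY)) addrACA.
- rewrite /bismut -frameZ; apply: frame_val; rewrite coframeZ christoffelZl.
  by rewrite (derive_dirZ _ _ (dco p Y sY)) scalerDr.
- rewrite /bismut -frameD; apply: frame_val; rewrite coframeD christoffelDr.
  by rewrite (derive_add _ (dco p Y sY) (dco p Y' sY')) addrACA.
- move=> f X Y sf sX sY p.
  have -> : Y p = frame (coframe Y) p by rewrite coframeK.
  rewrite /bismut -!frameZ -frameD.
  apply: frame_val; rewrite coframeZ christoffelZr.
  rewrite (derive_scale _ (smooth_differentiable p sf) (dco p Y sY)).
  by rewrite scalerDr addrA.
Qed.

Lemma smooth_ip (X Y : V -> V) :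
  smooth X -> smooth Y -> smooth (fun q => ip (X q) (Y q)).
Proof. exact: (@smooth_rV_bilinear _ _ (@ip R)). Qed.

Lemma derive_ip (X Y : V -> V) p v : differentiable X p -> differentiable Y p ->
  'D_v (fun q => ip (X q) (Y q)) p = ip ('D_v X p) (Y p) + ip (X p) ('D_v Y p).
Proof. exact: (@derive_rV_bilinear _ _ (@ip R)). Qed.

Lemma smooth_torsion3 (x y z : V -> V) : smooth x -> smooth y -> smooth z ->
  smooth (fun q => torsion3 n (x q) (y q) (z q)).
Proof.
move=> sx sy sz; rewrite /torsion3.
under [X in smooth X]funext do rewrite -mulN1r.
apply: smooth_scale; first exact: smooth_cst.
by apply: smooth_add; [apply: smooth_add|]; apply: smooth_ip => //;
  apply: smooth_lie.
Qed.

Lemma derive_torsion3 (x y z : V -> V) p v : smooth x -> smooth y -> smooth z ->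
  'D_v (fun q => torsion3 n (x q) (y q) (z q)) p =
    torsion3 n ('D_v x p) (y p) (z p) + torsion3 n (x p) ('D_v y p) (z p)
    + torsion3 n (x p) (y p) ('D_v z p).
Proof.
move=> sx sy sz; pose t (a b c : V -> V) q := ip (a q) (lie (b q) (c q)).
have st a b c : smooth a -> smooth b -> smooth c -> smooth (t a b c).
  by move=> sa sb sc; apply: smooth_ip => //; exact: smooth_lie.
have dt a b c : smooth a -> smooth b -> smooth c ->
    'D_v (t a b c) p = ip ('D_v a p) (lie (b p) (c p))
    + ip (a p) (lie ('D_v b p) (c p)) + ip (a p) (lie (b p) ('D_v c p)).
  move=> sa sb sc; have da := smooth_differentiable p sa.
  have db := smooth_differentiable p sb; have dc := smooth_differentiable p sc.
  rewrite derive_ip //; last exact/smooth_differentiable/smooth_lie.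
  by rewrite derive_lie // ipDr addrA.
have d1 := smooth_differentiable p (st x y z sx sy sz).
have d2 := smooth_differentiable p (st y z x sy sz sx).
have d3 := smooth_differentiable p (st z x y sz sx sy).
transitivity (- ('D_v (t x y z) p + 'D_v (t y z x) p + 'D_v (t z x y) p)).
  rewrite -(derive_add _ d1 d2) -(derive_add _ (differentiableD d1 d2) d3).
  apply: deriveN; apply: diff_derivable; apply: differentiableD d3.
  exact: differentiableD.
rewrite (dt x y z) // (dt y z x) // (dt z x y) //.
move: ('D_v x p) ('D_v y p) ('D_v z p) (x p) (y p) (z p) => dx dy dz u w t'.
by rewrite /torsion3; ring.
Qed.

Lemma torsion_bismut (Y Z : V -> V) p : smooth Y -> smooth Z ->
  coframe (torsion bismut Y Z) p =
    christoffel n (coframe Y p) (coframe Z p)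
    - christoffel n (coframe Z p) (coframe Y p)
    - lie (coframe Y p) (coframe Z p).
Proof.
move=> sY sZ; rewrite coframeB coframeB maurer_cartan // !coframe_bismut.
move: ('D_(Y p) _ p) ('D_(Z p) _ p) (lie _ _) => a b c.
by apply/rowP => k; rewrite !mxE; ring.
Qed.

Lemma torsion_form_bismut (X Y Z : V -> V) : smooth Y -> smooth Z ->
  torsion_form n bismut X Y Z =
    fun p => torsion3 n (coframe X p) (coframe Y p) (coframe Z p).
Proof.
move=> sY sZ; rewrite /torsion_form metricE; apply/funext => p.
by rewrite torsion_bismut // torsion3_christoffel.
Qed.

Lemma bismut_is_bismut : is_bismut n bismut.
Proof.
split; first exact: bismut_is_connection.
- move=> W X Y sW sX sY p; rewrite /nabla2 !metricE !coframe_bismut.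
  rewrite derive_ip; [|exact: differentiable_coframe..].
  rewrite ipDl ipDr christoffel_skew.
  by ring.
- move=> i hi W X sW sX p.
  rewrite /nabla_end !JfieldE /bismut -frameB frameK //.
  rewrite -[RHS](scale0r (frame (coframe W) p)) -frameZ; apply: frame_val.
  rewrite (@derive_linear _ _ _ (@J R i)); last exact: differentiable_coframe.
  by rewrite coframe_bismut christoffel_J // -linearD subrr scale0r.
split.
- move=> X Y Z sX sY sZ; rewrite torsion_form_bismut //.
  by apply: smooth_torsion3; exact: smooth_coframe.
- move=> X X' Y Z sX sX' sY sZ p; rewrite !torsion_form_bismut //.
  by rewrite coframeD torsion3D1.
- move=> f X Y Z sf sX sY sZ p; rewrite !torsion_form_bismut //.
  by rewrite coframeZ torsion3Z1.
- by move=> X Y Z sX sY sZ p; rewrite !torsion_form_bismut // torsion3_swap12.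
- by move=> X Y Z sX sY sZ p; rewrite !torsion_form_bismut // torsion3_swap23.
Qed.

(** Differentiating [torsion3] of the components by the Leibniz rule produces
    exactly the terms that the flat part of the connection removes. *)
Lemma nabla3_bismut (W X Y Z : V -> V) p :
  smooth W -> smooth X -> smooth Y -> smooth Z ->
  nabla3 bismut (torsion_form n bismut) W X Y Z p =
  - torsion3_act n (coframe W p) (coframe X p) (coframe Y p) (coframe Z p).
Proof.
move=> sW sX sY sZ; have sB := smooth_bismut sW.
rewrite /nabla3 !torsion_form_bismut //; try exact: sB.
rewrite derive_torsion3; [|exact: smooth_coframe..].
rewrite !coframe_bismut.
move: ('D_(W p) (coframe X) p) ('D_(W p) (coframe Y) p) ('D_(W p) (coframe Z) p)
  (coframe W p) (coframe X p) (coframe Y p) (coframe Z p) => dx dy dz w x y z.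
by rewrite /torsion3_act !(torsion3D1, torsion3D2, torsion3D3); ring.
Qed.

Lemma smooth_left_invariant (v : V) : smooth (frame (fun=> v)).
Proof. exact/smooth_frame/smooth_cst. Qed.

(** Left-invariant fields take every value at every point. *)
Lemma metric_inj (X Y : V -> V) p :
  (forall Z, smooth Z -> metric n X Z p = metric n Y Z p) -> X p = Y p.
Proof.
move=> h; rewrite -(coframeK hn X) -(coframeK hn Y); apply: frame_val.
apply: ip_inj => v; have := h _ (smooth_left_invariant v).
by rewrite !metricE frameK.
Qed.

End Bismut.

(** * Uniqueness of the Bismut connection *)

(** The expression A(y, z, x) - A(z, y, x), for A the difference of two metric
    connections, is the difference of their torsion forms.  Its skewness in x, y
    makes A cyclic, so the invariance of A under j on its last two arguments
    holds for any two, and A(x, y, z) = A(jx, jy, z) = - A(jx, y, jz)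
    = - A(x, y, z). *)
Lemma skew_torsion_J_eq0 (R : realType) (T : Type) (S : T -> Prop) (j : T -> T)
    (A : T -> T -> T -> R) :
  (forall x, S x -> S (j x)) ->
  (forall x y z, S x -> S y -> S z -> A x z y = - A x y z) ->
  (forall x y z, S x -> S y -> S z ->
    A x z y - A z x y = - (A y z x - A z y x)) ->
  (forall x y z, S x -> S y -> S z -> A x (j y) z = - A x y (j z)) ->
  (forall x y z, S x -> S y -> S z -> A x y (j (j z)) = - A x y z) ->
  forall x y z, S x -> S y -> S z -> A x y z = 0.
Proof.
move=> Sj A23 B AJ AJJ.
(* Skewness of A(y, z, x) - A(z, y, x) in x, y, together with that of A in its
   last two arguments, cancels down to cyclic invariance. *)
have cyc x y z : S x -> S y -> S z -> A y z x = A x y z.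
  move=> sx sy sz; have := B x y z sx sy sz.
  rewrite (A23 x y z) // (A23 z x y) // opprK -opprD.
  by move=> /oppr_inj /addIr ->.
have JJ23 x y z : S x -> S y -> S z -> A x (j y) (j z) = A x y z.
  by move=> sx sy sz; rewrite AJ ?AJJ ?opprK //; exact: Sj.
move=> x y z sx sy sz.
have JJ12 : A (j x) (j y) z = A x y z.
  by rewrite cyc ?JJ23 ?(cyc z x y) //; exact: Sj.
have JJ13 : A (j x) y (j z) = A x y z.
  by rewrite -cyc ?JJ23 ?(cyc x y z) //; exact: Sj.
have : A x y z = - A x y z by rewrite -[LHS]JJ12 AJ ?JJ13 //; exact: Sj.
by move=> /eqP; rewrite -addr_eq0 -mulr2n mulrn_eq0 => /eqP.
Qed.

Section Uniqueness.
Variables (R : realType) (n : brackets).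
Hypothesis hn : n \in [:: n1; n2; n3].
Local Notation V := 'rV[R]_8.
Local Notation coframe := (@coframe R n).

Lemma smooth_Jfield i (X : V -> V) : smooth X -> smooth (Jfield n i X).
Proof.
move=> sX; rewrite JfieldE; apply: smooth_frame.
by apply: (@smooth_linear _ _ _ (@J R i)); exact: smooth_coframe.
Qed.

Lemma metricC (X Y : V -> V) p : metric n X Y p = metric n Y X p.
Proof. by rewrite !metricE ipC. Qed.

Lemma metric_val (X X' Y : V -> V) p :
  X p = X' p -> metric n X Y p = metric n X' Y p.
Proof. by rewrite /metric => ->. Qed.

Lemma metric_Jfield i (X Y : V -> V) p : (1 <= i <= 3)%N ->
  metric n (Jfield n i X) Y p = - metric n X (Jfield n i Y) p.
Proof. by move=> hi; rewrite !metricE !JfieldE !frameK // ip_J. Qed.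

Lemma metric_JJfield i (X Y : V -> V) p : (1 <= i <= 3)%N ->
  metric n X (Jfield n i (Jfield n i Y)) p = - metric n X Y p.
Proof. by move=> hi; rewrite !metricE !JfieldE !frameK // JJ // ipNr. Qed.

Lemma metric_torsion (D : connection R) (X Y Z : V -> V) p :
  metric n X (torsion D Y Z) p = metric n (D Y Z) X p - metric n (D Z Y) X p
    - metric n (lie_bracket Y Z) X p.
Proof.
rewrite metricC !metricE /torsion !coframeB.
move: (coframe (D Y Z) p) (coframe (D Z Y) p) (coframe (lie_bracket Y Z) p).
by move=> a b c; rewrite ![ip _ (coframe X p)]ipC !ipBr.
Qed.

(** The pointwise difference of D and D' paired with a third field satisfies the
    hypotheses of [skew_torsion_J_eq0] for J_1 alone, and a vector orthogonal to
    all smooth fields at p is zero. *)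
Lemma bismut_unique (D D' : connection R) : is_bismut n D -> is_bismut n D' ->
  forall X Y, smooth X -> smooth Y -> D X Y = D' X Y.
Proof.
move=> [_ gD JD [_ _ _ cD12 cD23]] [_ gD' JD' [_ _ _ cD'12 cD'23]] X Y sX sY.
apply/funext => p.
pose A (X Y Z : V -> V) := metric n (D X Y) Z p - metric n (D' X Y) Z p.
suff A0 : forall X Y Z, smooth X -> smooth Y -> smooth Z -> A X Y Z = 0.
  by apply: (metric_inj hn) => Z sZ; apply: subr0_eq; exact: A0.
have skew (a b c b' c' : R) :
    a - b - c = 0 -> a - b' - c' = 0 -> c - c' = - (b - b').
  by move=> /subr0_eq <- /subr0_eq <-; ring.
have split4 (a b l a' b' : R) :
    (a - b - l) - (a' - b' - l) = (a - a') - (b - b').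
  by ring.
have oppB (a b a' b' : R) : a' = - a -> b' = - b -> a' - b' = - (a - b).
  by move=> -> ->; rewrite opprD.
(* Equalities are composed with [etrans] here: rewriting would compare distinct
   values of the metric by unfolding them to limits. *)
have BE U W Z : torsion_form n D U W Z p - torsion_form n D' U W Z p =
    A W Z U - A Z W U.
  have E := metric_torsion D U W Z p; have E' := metric_torsion D' U W Z p.
  exact: (etrans (congr2 (fun a b => a - b) E E') (split4 _ _ _ _ _)).
apply: (@skew_torsion_J_eq0 _ _ (@smooth R V) (Jfield n 1)).
- by move=> U sU; exact: smooth_Jfield.
- move=> U W Z sU sW sZ; rewrite /A (metricC (D U Z)) (metricC (D' U Z)).
  exact: (skew _ _ _ _ _ (gD U W Z sU sW sZ p) (gD' U W Z sU sW sZ p)).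
- move=> U W Z sU sW sZ.
  have BW : torsion_form n D W U Z p - torsion_form n D' W U Z p =
      - (torsion_form n D U W Z p - torsion_form n D' U W Z p).
    exact: (oppB _ _ _ _ (cD12 U W Z sU sW sZ p) (cD'12 U W Z sU sW sZ p)).
  exact: (etrans (esym (BE W U Z)) (etrans BW (congr1 -%R (BE U W Z)))).
- move=> U W Z sU sW sZ.
  have E : D U (Jfield n 1 W) p = Jfield n 1 (D U W) p.
    by apply: subr0_eq; exact: (JD 1%N isT U W sU sW p).
  have E' : D' U (Jfield n 1 W) p = Jfield n 1 (D' U W) p.
    by apply: subr0_eq; exact: (JD' 1%N isT U W sU sW p).
  exact: (oppB _ _ _ _
    (etrans (metric_val Z E) (@metric_Jfield 1 (D U W) Z p isT))
    (etrans (metric_val Z E') (@metric_Jfield 1 (D' U W) Z p isT))).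
- move=> U W Z sU sW sZ.
  exact: (oppB _ _ _ _ (@metric_JJfield 1 (D U W) Z p isT)
    (@metric_JJfield 1 (D' U W) Z p isT)).
Qed.

End Uniqueness.

(** * Parallel torsion *)

(** By uniqueness D may be replaced by [bismut], which reduces the statement to
    [nabla3_bismut]; conversely every quadruple of vectors is the value at a
    point of left-invariant fields. *)
Lemma parallel3_iff (R : realType) (n : brackets) (D : connection R) :
  n \in [:: n1; n2; n3] -> is_bismut n D ->
  parallel3 D (torsion_form n D) <->
  forall w x y z : 'rV[R]_8, torsion3_act n w x y z = 0.
Proof.
move=> hn hD; have uniq := bismut_unique hn hD (bismut_is_bismut R hn).
have sB := @smooth_bismut R n.
have tD X Y Z : smooth X -> smooth Y -> smooth Z ->
    torsion_form n D X Y Z = torsion_form n (@bismut R n) X Y Z.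
  by move=> sX sY sZ; rewrite /torsion_form /torsion !uniq.
pose B := @bismut R n; pose c := torsion_form n D; pose cB := torsion_form n B.
have nD W X Y Z p : smooth W -> smooth X -> smooth Y -> smooth Z ->
    nabla3 D c W X Y Z p =
    - torsion3_act n (coframe n W p) (coframe n X p) (coframe n Y p)
                     (coframe n Z p).
  move=> sW sX sY sZ; have sBW := sB W _ sW.
  have E0 : 'D_(W p) (c X Y Z) p = 'D_(W p) (cB X Y Z) p.
    exact: (congr1 (fun f => 'D_(W p) f p) (tD X Y Z sX sY sZ)).
  have E1 : c (D W X) Y Z p = cB (B W X) Y Z p.
    exact: (etrans (congr1 (fun F => c F Y Z p) (uniq W X sW sX))
      (congr1 (fun f => f p) (tD (B W X) Y Z (sBW X sX) sY sZ))).
  have E2 : c X (D W Y) Z p = cB X (B W Y) Z p.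
    exact: (etrans (congr1 (fun F => c X F Z p) (uniq W Y sW sY))
      (congr1 (fun f => f p) (tD X (B W Y) Z sX (sBW Y sY) sZ))).
  have E3 : c X Y (D W Z) p = cB X Y (B W Z) p.
    exact: (etrans (congr1 (fun F => c X Y F p) (uniq W Z sW sZ))
      (congr1 (fun f => f p) (tD X Y (B W Z) sX sY (sBW Z sZ)))).
  pose sub := fun a b : R => a - b.
  have E : nabla3 D c W X Y Z p = nabla3 B cB W X Y Z p.
    exact: (congr2 sub (congr2 sub (congr2 sub E0 E1) E2) E3).
  exact: (etrans E (nabla3_bismut hn p sW sX sY sZ)).
split=> [par w x y z|act0 W X Y Z sW sX sY sZ p]; last first.
  by rewrite nD // act0 oppr0.
have s := @smooth_left_invariant R n.
have := par _ _ _ _ (s w) (s x) (s y) (s z) 0.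
by rewrite nD // !frameK // => /eqP; rewrite oppr_eq0 => /eqP.
Qed.

Theorem mainTheorem7 (R : realType) :
  [/\ exists D : connection R, is_bismut n1 D,
      exists D : connection R, is_bismut n2 D
    & exists D : connection R, is_bismut n3 D] /\
  [/\ forall D : connection R, is_bismut n1 D ->
        parallel3 D (torsion_form n1 D),
      forall D : connection R, is_bismut n2 D ->
        ~ parallel3 D (torsion_form n2 D)
    & forall D : connection R, is_bismut n3 D ->
        ~ parallel3 D (torsion_form n3 D)].
Proof.
have nonparallel n (D : connection R) : n \in [:: n2; n3] -> is_bismut n D ->
    ~ parallel3 D (torsion_form n D).
  move=> hn hD /parallel3_iff; rewrite in_cons hn orbT => /(_ isT hD) act0.
  by have /eqP := torsion3_act_n23 R hn; rewrite act0 eq_sym pnatr_eq0.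
split; first by split; eexists; exact: bismut_is_bismut.
split=> D hD; [|exact: nonparallel..].
by apply/parallel3_iff => // w x y z; exact: torsion3_act_n1.
Qed.
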